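(* Assume (A1)--(A3), and let $(\mathbf{x}^*,\boldsymbol{\lambda}^* )$ be a saddle point as in (A2). For $k\ge 1$ let $\tilde{\mathbf{x}}^k=\frac1k\sum_{p=0}^{k-1}\hat{\mathbf{x}}^p$ be the ergodic average of the primal sequence generated by ADAL with parameters $\rho>0$ and $\tau\in(0,1/q)$. Then for all $k\ge 1$ $$F(\tilde{\mathbf{x}}^k)-F(\mathbf{x}^* )+\|\mathbf{r}(\tilde{\mathbf{x}}^k)\|\le \frac{1}{2k\tau}\,\phi,$$ where $\phi=\sum_{i=1}^N\rho\|\mathbf{A}_i(\mathbf{x}_i^0-\mathbf{x}_i^* )\|^2+\frac1\rho\big(\|\bar{\boldsymbol{\lambda}}^0\|+1\big)^2$.
   Context: Problem: minimize $F(\mathbf{x})=\sum_{i=1}^N f_i(\mathbf{x}_i)$ subject to $\sum_{i=1}^N\mathbf{A}_i\mathbf{x}_i=\mathbf{b}$ and $\mathbf{x}_i\in\mathcal{X}_i$, $i=1,\dots,N$. Here $f_i:\mathbb{R}^{n_i}\to\mathbb{R}$, $\mathcal{X}_i\subseteq\mathbb{R}^{n_i}$, $\mathbf{A}_i\in\mathbb{R}^{m\times n_i}$, $\mathbf{b}\in\mathbb{R}^m$, $n=\sum_i n_i$, $\mathbf{x}=[\mathbf{x}_1^\top,\dots,\mathbf{x}_N^\top]^\top\in\mathbb{R}^n$, $\mathbf{A}=[\mathbf{A}_1\dots\mathbf{A}_N]$, $\mathcal{X}=\mathcal{X}_1\times\dots\times\mathcal{X}_N$. The Lagrangian is $L(\mathbf{x},\boldsymbol{\lambda})=F(\mathbf{x})+\langle\boldsymbol{\lambda},\mathbf{A}\mathbf{x}-\mathbf{b}\rangle$.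 The residual is $\mathbf{r}(\mathbf{x})=\mathbf{A}\mathbf{x}-\mathbf{b}$. Norms are Euclidean. Degree: for each $j=1,\dots,m$ let $q_j$ be the number of indices $i$ such that the $j$-th row of $\mathbf{A}_i$ is nonzero; $q=\max_j q_j$. ADAL with penalty parameter $\rho>0$ and stepsize $\tau\in(0,1/q)$: given initial $\boldsymbol{\lambda}^0\in\mathbb{R}^m$ and $\mathbf{x}^0$, for $k=0,1,2,\dots$: (1) for every $i$, $\hat{\mathbf{x}}_i^k$ is a solution of the subproblem $\min_{\mathbf{x}_i\in\mathcal{X}_i}\ f_i(\mathbf{x}_i)+\langle\boldsymbol{\lambda}^k,\mathbf{A}_i\mathbf{x}_i\rangle+\frac\rho2\big\|\mathbf{A}_i\mathbf{x}_i+\sum_{j\ne i}\mathbf{A}_j\mathbf{x}_j^k-\mathbf{b}\big\|^2$; (2) $\mathbf{x}_i^{k+1}=\mathbf{x}_i^k+\tau(\hat{\mathbf{x}}_i^k-\mathbf{x}_i^k)$ for every $i$; (3) $\boldsymbol{\lambda}^{k+1}=\boldsymbol{\lambda}^k+\rho\tau\big(\sum_{i=1}^N\mathbf{A}_i\mathbf{x}_i^{k+1}-\mathbf{b}\big)$. (The algorithm may stop in step 3 if $\mathbf{A}\mathbf{x}^{k+1}=\mathbf{b}$ and $\mathbf{A}_i\hat{\mathbf{x}}_i^k=\mathbf{A}_i\mathbf{x}_i^k$ for all $i$; apart from this stopping test the statement concerns the sequences defined by (1)--(3).) Auxiliary dual variable: $\bar{\boldsymbol{\lambda}}^k=\boldsymbol{\lambda}^k+\rho(1-\tau)\mathbf{r}(\mathbf{x}^k)$.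 Assumptions: (A1) the functions $f_i$ are convex (not necessarily differentiable) and the sets $\mathcal{X}_i$ are convex, closed and bounded. (A2) $L$ has a saddle point $(\mathbf{x}^*,\boldsymbol{\lambda}^* )\in\mathbb{R}^n\times\mathbb{R}^m$, i.e. $L(\mathbf{x}^*,\boldsymbol{\lambda})\le L(\mathbf{x}^*,\boldsymbol{\lambda}^* )\le L(\mathbf{x},\boldsymbol{\lambda}^* )$ for all $\mathbf{x}\in\mathcal{X}$, $\boldsymbol{\lambda}\in\mathbb{R}^m$; in particular $\mathbf{x}^*$ is an optimal solution of the problem. (A3) All subproblems in step (1) are exactly solvable at every iteration. *)

(* Defs.v *)
From HB Require Import structures.
From mathcomp Require Import all_boot all_order all_algebra.
From mathcomp Require Import all_classical all_reals all_analysis.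

Set Implicit Arguments.
Unset Strict Implicit.
Unset Printing Implicit Defensive.

Import Order.TTheory GRing.Theory Num.Theory.
Import numFieldNormedType.Exports.

Local Open Scope classical_set_scope.
Local Open Scope ring_scope.

(* The library norm `|v| on matrices is the sup norm, hence a separate
   Euclidean norm. *)
Definition dotv (R : realType) (d : nat) (u v : 'cV[R]_d) : R :=
  \sum_(j < d) u j 0 * v j 0.

Definition norm2 (R : realType) (d : nat) (u : 'cV[R]_d) : R :=
  Num.sqrt (dotv u u).

Definition minimizer_on (R : realType) (T : Type) (D : set T) (g : T -> R)
    (y : T) : Prop :=
  D y /\ forall z, D z -> g y <= g z.

(* A vector x = [x_1; ...; x_N] of R^(n_1 + ... + n_N) is represented by the
   family of its blocks. *)
Definition blockvec (R : realType) (N : nat) (n : 'I_N -> nat) : Type :=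
  forall i : 'I_N, 'cV[R]_(n i).

Section Problem.
Variables (R : realType) (N m : nat) (n : 'I_N -> nat).
Variables (f : forall i, 'cV[R]_(n i) -> R) (X : forall i, set 'cV[R]_(n i)).
Variables (A : forall i, 'M[R]_(m, n i)) (b : 'cV[R]_m).
Implicit Types (x : blockvec R n) (lam : 'cV[R]_m).

Definition objective x : R := \sum_i f (x i).

Definition residual x : 'cV[R]_m := \sum_i A i *m x i - b.

Definition lagrangian x lam : R := objective x + dotv lam (residual x).

Definition in_domain x : Prop := forall i, X (x i).

(* Membership of the primal component in the product set X is part of the
   notion (the saddle point is a primal optimal solution). *)
Definition saddle_point x lam : Prop :=
  in_domain x /\
  forall (y : blockvec R n) (mu : 'cV[R]_m), in_domain y ->
    lagrangian x mu <= lagrangian x lam /\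
    lagrangian x lam <= lagrangian y lam.

Definition row_degree (j : 'I_m) : nat := #|[pred i : 'I_N | row j (A i) != 0]|.

Definition max_degree : nat := \max_(j < m) row_degree j.

Definition subproblem_objective (rho : R) x lam (i : 'I_N)
    (z : 'cV[R]_(n i)) : R :=
  f z + dotv lam (A i *m z)
  + rho / 2 * norm2 (A i *m z + \sum_(j | j != i) A j *m x j - b) ^+ 2.

(* A run of the method: primal iterates x, subproblem solutions xhat,
   multipliers lam; x 0 and lam 0 are arbitrary. *)
Definition adal_sequence (rho tau : R) (x xhat : nat -> blockvec R n)
    (lam : nat -> 'cV[R]_m) : Prop :=
  forall k : nat,
    [/\ forall i, minimizer_on (X (i:=i))
          (subproblem_objective rho (x k) (lam k) (i:=i)) (xhat k i),
        forall i, x k.+1 i = x k i + tau *: (xhat k i - x k i)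
      & lam k.+1 = lam k + (rho * tau) *: (\sum_i A i *m x k.+1 i - b)].

Definition lambda_bar (rho tau : R) x lam : 'cV[R]_m :=
  lam + (rho * (1 - tau)) *: residual x.

End Problem.

Definition ergodic_average (R : realType) (N : nat) (n : 'I_N -> nat)
    (xhat : nat -> blockvec R n) (k : nat) : blockvec R n :=
  fun i => k%:R^-1 *: \sum_(p < k) xhat p i.

(* Main.v *)
Require Import Defs.
From HB Require Import structures.
From mathcomp Require Import all_boot all_order all_algebra.
From mathcomp Require Import all_classical all_reals all_analysis.
From mathcomp Require Import ring lra.

Set Implicit Arguments.
Unset Strict Implicit.
Unset Printing Implicit Defensive.

Import Order.TTheory GRing.Theory Num.Theory.
Import numFieldNormedType.Exports.

Local Open Scope classical_set_scope.
Local Open Scope ring_scope.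

(** The proof is a telescoping argument.  Write a_i = A_i (x_i - xstar_i) and
    d_i = A_i (xhat_i - x_i) at a given iteration, and r for the residual map.

    Since xhat_i minimizes a convex function plus a quadratic, it satisfies a
    first-order variational inequality ([minimizer_variational]).  Testing it
    at xstar_i and summing over i bounds the objective gap of xhat
    ([subproblems_gap]).  The auxiliary multiplier is chosen so that it moves
    by exactly rho tau r(xhat) per iteration ([lambda_bar_step]), while a_i
    moves by tau d_i.  Expanding squares then shows that, for every fixed
    multiplier mu, the merit function
      sum_i rho |a_i|^2 + |lambda_bar - mu|^2 / rho
    decreases by at least 2 tau (F(xhat) - F(xstar) + <mu, r(xhat)>)
    ([merit_decrease]).  The terms of second order in the step are absorbed
    because the subproblems are solved in parallel but each constraint couples
    at most q blocks, so |sum_i d_i|^2 <= q sum_i |d_i|^2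
    ([norm2_sum_le_degree]), and tau q < 1.

    Summing over the iterations, convexity of F and affinity of r transfer the
    bound to the ergodic average.  As mu is free, it is finally taken in the
    unit ball along the residual of the average ([norm2_dual]): the pairing
    <mu, r> becomes the norm, and |lambda_bar - mu| <= |lambda_bar| + 1. *)

(** * Euclidean inner product and norm *)

Section Euclidean.
Variables (R : realType) (d : nat).
Implicit Types (u v w : 'cV[R]_d) (c : R).

Lemma dotvC u v : dotv u v = dotv v u.
Proof. by apply: eq_bigr => j _; rewrite mulrC. Qed.

Lemma dotvDl u v w : dotv (u + v) w = dotv u w + dotv v w.
Proof. by rewrite -big_split; apply: eq_bigr => j _ /=; rewrite mxE mulrDl. Qed.

Lemma dotvDr u v w : dotv w (u + v) = dotv w u + dotv w v.
Proof. by rewrite dotvC dotvDl !(dotvC w). Qed.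

Lemma dotvZl c u v : dotv (c *: u) v = c * dotv u v.
Proof. by rewrite mulr_sumr; apply: eq_bigr => j _ /=; rewrite mxE mulrA. Qed.

Lemma dotvZr c u v : dotv v (c *: u) = c * dotv v u.
Proof. by rewrite dotvC dotvZl dotvC. Qed.

Lemma dotvNl u v : dotv (- u) v = - dotv u v.
Proof. by rewrite -scaleN1r dotvZl mulN1r. Qed.

Lemma dotvNr u v : dotv v (- u) = - dotv v u.
Proof. by rewrite dotvC dotvNl dotvC. Qed.

Lemma dotv0r u : dotv u 0 = 0.
Proof. by rewrite -(scale0r u) dotvZr mul0r. Qed.

Lemma dotv_sumr (I : Type) (s : seq I) (P : pred I) (F : I -> 'cV[R]_d) u :
  dotv u (\sum_(i <- s | P i) F i) = \sum_(i <- s | P i) dotv u (F i).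
Proof.
exact: (big_morph (dotv u) (fun v w => dotvDr v w u) (dotv0r u)).
Qed.

Definition dotvE := (dotvDl, dotvDr, dotvZl, dotvZr, dotvNl, dotvNr).

Lemma dotv_ge0 u : 0 <= dotv u u.
Proof. by apply: sumr_ge0 => j _; rewrite -expr2 sqr_ge0. Qed.

Lemma dotv_eq0 u : dotv u u = 0 -> u = 0.
Proof.
move=> /psumr_eq0P u0; apply/matrixP => j l; rewrite ord1 mxE.
have /eqP := u0 (fun j _ => sqr_ge0 (u j 0)) j isT.
by rewrite mulf_eq0 orbb => /eqP.
Qed.

Lemma norm2_ge0 u : 0 <= norm2 u.
Proof. exact: sqrtr_ge0. Qed.

Lemma norm2_sqr u : norm2 u ^+ 2 = dotv u u.
Proof. by rewrite sqr_sqrtr ?dotv_ge0. Qed.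

Lemma cauchy_schwarz u v : dotv u v <= norm2 u * norm2 v.
Proof.
have [/eqP|uv_neq0] := eqVneq (norm2 u * norm2 v) 0.
  rewrite mulf_eq0 -2!(sqrf_eq0 (norm2 _)) !norm2_sqr => uv0.
  suff -> : dotv u v = 0 by rewrite mulr_ge0 ?norm2_ge0.
  case/orP: uv0 => /eqP/dotv_eq0 ->; rewrite ?dotv0r//.
  by rewrite dotvC dotv0r.
have uv_gt0 : 0 < norm2 u * norm2 v.
  by rewrite lt_def uv_neq0 mulr_ge0 ?norm2_ge0.
rewrite -(ler_pM2l uv_gt0).
have := dotv_ge0 (norm2 v *: u - norm2 u *: v).
by rewrite !dotvE (dotvC v u) -!norm2_sqr; lra.
Qed.

Lemma norm2B_le u v : norm2 (u - v) <= norm2 u + norm2 v.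
Proof.
rewrite -ler_sqr ?nnegrE ?addr_ge0 ?norm2_ge0//.
have := cauchy_schwarz (- u) v.
have -> : norm2 (- u) = norm2 u by rewrite /norm2 !dotvE opprK.
by rewrite norm2_sqr sqrrD !norm2_sqr !dotvE (dotvC v u); lra.
Qed.

(** The Euclidean norm is its own dual norm, and the supremum over the unit
    ball is attained: this is how a bound on all <mu, r> becomes one on |r|. *)
Lemma norm2_dual u : exists2 mu, norm2 mu <= 1 & dotv mu u = norm2 u.
Proof.
have [u0|u_neq0] := eqVneq (norm2 u) 0.
  exists 0; first by rewrite /norm2 dotv0r sqrtr0.
  by rewrite dotvC dotv0r.
exists ((norm2 u)^-1 *: u); last first.
  by rewrite dotvZl -norm2_sqr; field.
rewrite -(@ler_pXn2r _ 2) ?nnegrE ?norm2_ge0// norm2_sqr !dotvE -norm2_sqr.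
by rewrite le_eqVlt; apply/orP; left; apply/eqP; field.
Qed.

End Euclidean.

(** The gap between the two sides is, up to the factor #|P|, a sum of squared
    deviations from the mean. *)
Lemma sqr_sum_le_card (R : realFieldType) (I : finType) (P : pred I)
    (a : I -> R) :
  (\sum_(i | P i) a i) ^+ 2 <= #|P|%:R * \sum_(i | P i) a i ^+ 2.
Proof.
set S := \sum_(i | P i) a i; set Q := \sum_(i | P i) _; set c : R := #|P|%:R.
have [P0|P_gt0] := posnP #|P|.
  rewrite /c P0 mul0r /S big_pred0 ?expr0n// => i.
  by have := card0_eq P0 i.
have c_gt0 : 0 < c by rewrite ltr0n.
have: 0 <= \sum_(i | P i) (c * a i - S) ^+ 2.
  by apply: sumr_ge0 => i _; exact: sqr_ge0.
have -> : \sum_(i | P i) (c * a i - S) ^+ 2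
    = c ^+ 2 * Q - 2 * c * S * S + c * S ^+ 2.
  rewrite [c ^+ 2 * Q]mulr_sumr [2 * c * S * S]mulr_sumr.
  have -> : c * S ^+ 2 = \sum_(i | P i) S ^+ 2 by rewrite sumr_const -mulr_natl.
  rewrite -sumrB -big_split; apply: eq_bigr => i _ /=; ring.
by move=> var_ge0; rewrite -(ler_pM2l c_gt0); lra.
Qed.

(** * Convexity and first-order optimality *)

Section Convexity.
Variables (R : realType) (E : lmodType R).

Lemma convex_functionP (f : E -> R) : @convex_function R E setT f ->
  forall (t : R) (x y : E), 0 <= t -> t <= 1 ->
  f (t *: x + (1 - t) *: y) <= t * f x + (1 - t) * f y.
Proof.
move=> cf t x y t0 t1.
exact: (cf (Itv01 t0 t1) x y (in_setT _) (in_setT _)).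
Qed.

Lemma convex_setP (X : set E) : @convex_set R E X ->
  forall (t : R) (x y : E), 0 <= t -> t <= 1 -> X x -> X y ->
  X (t *: x + (1 - t) *: y).
Proof.
move=> cX t x y t0 t1 Xx Xy.
by apply/set_mem/(cX x y (Itv01 t0 t1)); exact: mem_set.
Qed.

(** The average of k+1 points is a convex combination, with weights k/(k+1)
    and 1/(k+1), of the average of the first k points and the last one. *)
Lemma jensen_average (f : E -> R) (y : nat -> E) (k : nat) :
    @convex_function R E setT f -> (0 < k)%N ->
  k%:R * f (k%:R^-1 *: \sum_(p < k) y p) <= \sum_(p < k) f (y p).
Proof.
move=> cf; case: k => // k _; elim: k => [|k IH].
  by rewrite !big_ord1 invr1 scale1r mul1r.
rewrite big_ord_recr [leRHS]big_ord_recr /= -natr1.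
have : 0 < k.+1%:R :> R by rewrite ltr0n.
move: (\sum_(p < k.+1) y p) (k.+1%:R) IH => S c IH c_gt0.
have c1_gt0 : 0 < c + 1 by rewrite addr_gt0.
have [c_neq0 c1_neq0] : c != 0 /\ c + 1 != 0 by rewrite !gt_eqF.
pose t := c / (c + 1).
have -> : (c + 1)^-1 *: (S + y k.+1)
    = t *: (c^-1 *: S) + (1 - t) *: y k.+1.
  rewrite scalerDr scalerA /t; congr (_ *: _ + _ *: _); field => //.
  by rewrite c_neq0.
have t0 : 0 <= t by rewrite divr_ge0 // ltW.
have t1 : t <= 1 by rewrite ler_pdivrMr// mul1r lerDl.
have fle := convex_functionP cf (c^-1 *: S) (y k.+1) t0 t1.
apply: le_trans (_ : c * f (c^-1 *: S) + f (y k.+1) <= _);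
  last by rewrite lerD2r.
apply: le_trans (ler_wpM2l (ltW c1_gt0) fle) _.
by rewrite le_eqVlt; apply/orP; left; apply/eqP; rewrite /t; field.
Qed.

End Convexity.

(** The limit t -> 0+ of the hypothesis, which is how difference quotients
    along a segment yield first-order conditions. *)
Lemma ge0_of_affine_ge0 (R : realFieldType) (a c : R) :
  (forall t, 0 < t -> t <= 1 -> 0 <= a + t * c) -> 0 <= a.
Proof.
move=> aff; rewrite leNgt; apply/negP => a_lt0.
have den_gt0 : 0 < `|c| - a by rewrite ltr_wpDl ?oppr_gt0.
(* Half of the value at which t * |c| would reach (1 - t) * - a. *)
pose t := - a / (`|c| - a) / 2.
have t_gt0 : 0 < t by rewrite !divr_gt0 ?oppr_gt0.
have t1 : t <= 1.
  rewrite ler_pdivrMr// ler_pdivrMr// mul1r.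
  by have := normr_ge0 c; lra.
have := aff t t_gt0 t1.
have tcE : t * (`|c| - a) = - a / 2 by rewrite /t; field; rewrite gt_eqF.
have : t * c <= t * `|c| by rewrite ler_wpM2l ?ler_norm// ltW.
have : 0 <= t * - a by apply: mulr_ge0; rewrite ?oppr_ge0; exact: ltW.
by lra.
Qed.

(** Compare y with the points t z + (1 - t) y of X.  Convexity bounds f there,
    the linear and quadratic terms expand exactly, and dividing by t leaves a
    remainder that vanishes with t; f itself need not be differentiable. *)
Lemma minimizer_variational (R : realType) (m p : nat)
    (f : 'cV[R]_p -> R) (X : set 'cV[R]_p) (A : 'M[R]_(m, p))
    (lam s b : 'cV[R]_m) (rho : R) (y z : 'cV[R]_p) :
  @convex_function R 'cV[R]_p setT f -> @convex_set R 'cV[R]_p X ->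
  minimizer_on X (fun w => f w + dotv lam (A *m w)
                           + rho / 2 * norm2 (A *m w + s - b) ^+ 2) y ->
  X z ->
  f y - f z <= dotv (lam + rho *: (A *m y + s - b)) (A *m z - A *m y).
Proof.
move=> cf cX [Xy ymin] Xz; rewrite -subr_ge0.
apply: (@ge0_of_affine_ge0 _ _
  (rho / 2 * dotv (A *m z - A *m y) (A *m z - A *m y))) => t t_gt0 t1.
have ft := convex_functionP cf z y (ltW t_gt0) t1.
have := ymin _ (convex_setP cX (ltW t_gt0) t1 Xz Xy).
rewrite -(pmulr_rge0 _ t_gt0) !norm2_sqr mulmxDr -!scalemxAr -!addrA.
move: (A *m z) (A *m y) (s - b) => u v c.
rewrite !dotvE (dotvC u v) (dotvC c v) (dotvC c u).
by move: ft; lra.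
Qed.

(** * Coupling of the blocks through the constraint matrix *)

Section Degree.
Variables (R : realType) (N m : nat) (n : 'I_N -> nat).
Variables (A : forall i, 'M[R]_(m, n i)).
Implicit Types (y : blockvec R n).

Lemma mulmx_row0 i j (v : 'cV[R]_(n i)) : row j (A i) = 0 -> (A i *m v) j 0 = 0.
Proof.
move=> Aij; transitivity (row j (A i *m v) 0 0); first by rewrite [RHS]mxE.
by rewrite row_mul Aij mul0mx mxE.
Qed.

Lemma row_degree_le_max j : (row_degree A j <= max_degree A)%N.
Proof. exact: (leq_bigmax (F := row_degree A)). Qed.

Lemma sum_norm2_sqrE y :
  \sum_i norm2 (A i *m y i) ^+ 2 = \sum_j \sum_i (A i *m y i) j 0 ^+ 2.
Proof.
rewrite exchange_big; apply: eq_bigr => i _ /=; rewrite norm2_sqr.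
by apply: eq_bigr => j _; rewrite expr2.
Qed.

(** In coordinate j only the blocks whose matrix has a nonzero j-th row
    contribute, and there are at most q of them. *)
Lemma norm2_sum_le_degree y :
  norm2 (\sum_i A i *m y i) ^+ 2
    <= (max_degree A)%:R * \sum_i norm2 (A i *m y i) ^+ 2.
Proof.
rewrite sum_norm2_sqrE mulr_sumr norm2_sqr; apply: ler_sum => j _.
pose P := [pred i : 'I_N | row j (A i) != 0].
have offP (g : R -> R) : g 0 = 0 ->
    \sum_i g ((A i *m y i) j 0) = \sum_(i | P i) g ((A i *m y i) j 0).
  move=> g0; rewrite [RHS]big_mkcond; apply: eq_bigr => i _ /=.
  by case: eqP => //= Aij; rewrite mulmx_row0.
rewrite summxE -expr2 (offP id)// (offP (fun c => c ^+ 2)) ?expr0n//.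
apply: le_trans (sqr_sum_le_card _ _) _; apply: ler_wpM2r.
  by apply: sumr_ge0 => i _; exact: sqr_ge0.
by rewrite ler_nat row_degree_le_max.
Qed.

(** If some coordinate of some A_i y_i is nonzero, then q >= 1.  With
    d_i = A_i y_i and tau q < 1 this yields
    tau sum_i |d_i|^2 <= sum_i |d_i|^2 uniformly, including the degenerate
    case q = 0, where tau is unbounded but all d_i vanish. *)
Lemma sum_norm2_le_degree y :
  \sum_i norm2 (A i *m y i) ^+ 2
    <= (max_degree A)%:R * \sum_i norm2 (A i *m y i) ^+ 2.
Proof.
rewrite sum_norm2_sqrE mulr_sumr; apply: ler_sum => j _.
rewrite mulr_sumr; apply: ler_sum => i _.
have [Aij|Aij] := eqVneq (row j (A i)) 0.
  by rewrite mulmx_row0// expr0n mulr0.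
apply: ler_peMl; first exact: sqr_ge0.
rewrite ler1n; apply: leq_trans (row_degree_le_max j).
by apply/card_gt0P; exists i.
Qed.

End Degree.

(** * One iteration *)

Section Iteration.
Variables (R : realType) (N m : nat) (n : 'I_N -> nat).
Variables (f : forall i, 'cV[R]_(n i) -> R) (X : forall i, set 'cV[R]_(n i)).
Variables (A : forall i, 'M[R]_(m, n i)) (b : 'cV[R]_m) (rho tau : R).
Implicit Types (x xhat y z : blockvec R n) (lam mu : 'cV[R]_m).

(** The Lagrangian is affine in the multiplier, so it is bounded above in that
    variable only if the residual vanishes; moving the multiplier along the
    residual suffices. *)
Lemma saddle_feasible y lam :
  saddle_point f X A b y lam -> residual A b y = 0.
Proof.
case=> yX sad; apply: dotv_eq0; apply/eqP; rewrite eq_le dotv_ge0 andbT.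
have [+ _] := sad y (lam + residual A b y) yX.
by rewrite /lagrangian dotvDl; lra.
Qed.

Lemma residualB y z :
  residual A b y - residual A b z = \sum_i A i *m (y i - z i).
Proof.
rewrite opprB addrA subrK -sumrB; apply: eq_bigr => i _.
by rewrite mulmxBr.
Qed.

(** The factor 1 - tau in the auxiliary multiplier compensates for the part of
    r(x') = (1 - tau) r(x) + tau r(xhat) inherited from the previous iterate,
    leaving an increment driven by the subproblem solutions only. *)
Lemma lambda_bar_step x x' xhat lam :
    (forall i, x' i = x i + tau *: (xhat i - x i)) ->
  lambda_bar A b rho tau x' (lam + (rho * tau) *: residual A b x')
    = lambda_bar A b rho tau x lam + (rho * tau) *: residual A b xhat.
Proof.
move=> x'E; rewrite /lambda_bar.
have -> : residual A b x'
    = residual A b x + tau *: (residual A b xhat - residual A b x).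
  rewrite residualB -[LHS](subrK (residual A b x)) residualB addrC scaler_sumr.
  congr (_ + _); apply: eq_bigr => i _.
  by rewrite x'E addrC addKr -scalemxAr.
move: (residual A b x) (residual A b xhat) => r rh.
by apply/matrixP => j l; rewrite !mxE; ring.
Qed.

(** Each subproblem sees the residual A_i xhat_i + sum_(j != i) A_j x_j - b
    instead of r(x).  The difference is the block displacement
    A_i (xhat_i - x_i), which produces the last sum. *)
Lemma subproblems_gap x xhat y lam :
    (forall i, @convex_function R 'cV[R]_(n i) setT (@f i)) ->
    (forall i, @convex_set R 'cV[R]_(n i) (@X i)) ->
    (forall i, minimizer_on (@X i)
       (subproblem_objective f A b rho x lam (i:=i)) (xhat i)) ->
    in_domain X y -> residual A b y = 0 ->
  objective f xhat - objective f y
    <= - dotv (lam + rho *: residual A b x) (residual A b xhat)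
       - rho * \sum_i dotv (A i *m (xhat i - x i)) (A i *m (xhat i - y i)).
Proof.
move=> cf cX xhat_min yX y0.
have -> : - dotv (lam + rho *: residual A b x) (residual A b xhat)
    = \sum_i dotv (lam + rho *: residual A b x) (A i *m (y i - xhat i)).
  by rewrite -dotv_sumr -residualB y0 sub0r dotvNr.
rewrite -sumrB mulr_sumr -sumrB; apply: ler_sum => i _.
apply: le_trans (minimizer_variational (cf i) (cX i) (xhat_min i) (yX i)) _.
have -> : A i *m xhat i + \sum_(j | j != i) A j *m x j - b
    = residual A b x + A i *m (xhat i - x i).
  rewrite /residual [X in _ = X - b + _](bigD1 i)//= mulmxBr.
  move: (A i *m xhat i) (A i *m x i) (\sum_(j | j != i) _) => u v w.
  by apply/matrixP => j l; rewrite !mxE; ring.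
by rewrite !mulmxBr !dotvE; lra.
Qed.

(** The Lyapunov function of the method, with an arbitrary reference
    multiplier [mu] in place of a dual optimum. *)
Definition merit y mu x lam : R :=
  \sum_i rho * norm2 (A i *m (x i - y i)) ^+ 2
  + rho^-1 * norm2 (lambda_bar A b rho tau x lam - mu) ^+ 2.

Lemma merit_ge0 y mu x lam : 0 < rho -> 0 <= merit y mu x lam.
Proof.
move=> rho_gt0; apply: addr_ge0; last first.
  by rewrite mulr_ge0 ?invr_ge0 ?sqr_ge0// ltW.
by apply: sumr_ge0 => i _; rewrite mulr_ge0 ?sqr_ge0// ltW.
Qed.

(** Let d_i = A_i (xhat_i - x_i), S = sum_i |d_i|^2 and
    D = sum_i d_i = r(xhat) - r(x).  Once the gap is bounded by
    [subproblems_gap], all terms cancel except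
      rho tau (tau S + tau |D|^2 - tau |r(x)|^2 - 2 S),
    which is nonpositive since tau S <= S and tau |D|^2 <= S. *)
Lemma merit_decrease x x' xhat y lam mu :
    (forall i, @convex_function R 'cV[R]_(n i) setT (@f i)) ->
    (forall i, @convex_set R 'cV[R]_(n i) (@X i)) ->
    0 < rho -> 0 < tau -> tau * (max_degree A)%:R < 1 ->
    in_domain X y -> residual A b y = 0 ->
    (forall i, minimizer_on (@X i)
       (subproblem_objective f A b rho x lam (i:=i)) (xhat i)) ->
    (forall i, x' i = x i + tau *: (xhat i - x i)) ->
  2 * tau * (objective f xhat - objective f y + dotv mu (residual A b xhat))
    + merit y mu x' (lam + (rho * tau) *: residual A b x')
  <= merit y mu x lam.
Proof.
move=> cf cX rho_gt0 tau_gt0 tau_lt yX y0 xhat_min x'E.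
have gap := subproblems_gap cf cX xhat_min yX y0.
rewrite /merit (lambda_bar_step _ x'E).
set r := residual A b x in gap *; set rh := residual A b xhat in gap *.
pose a i := A i *m (x i - y i); pose d i := A i *m (xhat i - x i).
pose S := \sum_i norm2 (d i) ^+ 2; pose T := \sum_i dotv (a i) (d i).
have lamE : lam + rho *: r = lambda_bar A b rho tau x lam + (rho * tau) *: r.
  by apply/matrixP => j l; rewrite /lambda_bar -/r !mxE; ring.
have crossE : \sum_i dotv (A i *m (xhat i - x i)) (A i *m (xhat i - y i))
    = T + S.
  rewrite -big_split; apply: eq_bigr => i _ /=.
  have -> : A i *m (xhat i - y i) = a i + d i.
    by rewrite -mulmxDr [x i - y i + _]addrC subrKA.
  by rewrite -/(d i) dotvDr -norm2_sqr dotvC.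
have primalE : \sum_i rho * norm2 (A i *m (x' i - y i)) ^+ 2
    = \sum_i rho * norm2 (a i) ^+ 2 + 2 * rho * tau * T + rho * tau ^+ 2 * S.
  rewrite [2 * _ * _ * T]mulr_sumr [_ * S]mulr_sumr -!big_split.
  apply: eq_bigr => i _ /=.
  have -> : A i *m (x' i - y i) = a i + tau *: d i.
    by rewrite x'E addrAC mulmxDr -scalemxAr.
  by rewrite !norm2_sqr !dotvE (dotvC (d i)); ring.
have sumdE : rh - r = \sum_i d i by rewrite residualB.
set lb := lambda_bar _ _ _ _ _ _ in lamE *.
have dualE : rho^-1 * norm2 (lb + (rho * tau) *: rh - mu) ^+ 2
    = rho^-1 * norm2 (lb - mu) ^+ 2 + 2 * tau * dotv (lb - mu) rh
      + rho * tau ^+ 2 * dotv rh rh.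
  rewrite addrAC !norm2_sqr; move: (lb - mu) (rh) => l v.
  by rewrite !dotvE (dotvC v l); field; rewrite gt_eqF.
have S_ge0 : 0 <= S by apply: sumr_ge0 => i _; exact: sqr_ge0.
have tauS : tau * (max_degree A)%:R * S <= S by rewrite ler_piMl// ltW.
have boundD : tau * dotv (rh - r) (rh - r) <= S.
  rewrite -norm2_sqr sumdE; apply: le_trans tauS; rewrite -mulrA.
  by rewrite ler_wpM2l ?(ltW tau_gt0)// norm2_sum_le_degree.
have boundS : tau * S <= S.
  apply: le_trans tauS; rewrite -mulrA.
  by rewrite ler_wpM2l ?(ltW tau_gt0)// sum_norm2_le_degree.
rewrite lamE crossE in gap; rewrite primalE dualE.
have rt_gt0 : 0 < rho * tau by rewrite mulr_gt0.
have boundr : 0 <= tau * dotv r r by rewrite mulr_ge0 ?dotv_ge0 ?ltW.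
have := ler_wpM2l (ltW rt_gt0) (lerD boundD boundS).
have := mulr_ge0 (ltW rt_gt0) boundr.
have tau2_gt0 : 0 < 2 * tau by rewrite mulr_gt0.
have := ler_wpM2l (ltW tau2_gt0) gap.
(* The residuals are opaque from here on, so that the expansion below stops
   at inner products of lb, mu, r and rh. *)
clearbody lb r rh; rewrite !dotvE (dotvC rh r).
by lra.
Qed.

End Iteration.

(** * Ergodic averages *)

Lemma merit_telescope (R : realType) (N m : nat) (n : 'I_N -> nat)
    (f : forall i, 'cV[R]_(n i) -> R) (X : forall i, set 'cV[R]_(n i))
    (A : forall i, 'M[R]_(m, n i)) (b : 'cV[R]_m) (rho tau : R)
    (x xhat : nat -> blockvec R n) (lam : nat -> 'cV[R]_m)
    (y : blockvec R n) (mu : 'cV[R]_m) (k : nat) :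
    (forall i, @convex_function R 'cV[R]_(n i) setT (f i)) ->
    (forall i, @convex_set R 'cV[R]_(n i) (X i)) ->
    0 < rho -> 0 < tau -> tau * (max_degree A)%:R < 1 ->
    in_domain X y -> residual A b y = 0 ->
    adal_sequence f X A b rho tau x xhat lam ->
  2 * tau * \sum_(p < k) (objective f (xhat p) - objective f y
                          + dotv mu (residual A b (xhat p)))
    + merit A b rho tau y mu (x k) (lam k)
  <= merit A b rho tau y mu (x 0%N) (lam 0%N).
Proof.
move=> cf cX rho_gt0 tau_gt0 tau_lt yX y0 run.
elim: k => [|k IH]; first by rewrite big_ord0 mulr0 add0r.
have [xhat_min xS lamS] := run k.
have := merit_decrease mu cf cX rho_gt0 tau_gt0 tau_lt yX y0 xhat_min xS.
rewrite -lamS => step; rewrite big_ord_recr /= mulrDr.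
by apply: le_trans IH; rewrite -addrA lerD2l.
Qed.

Lemma residual_ergodic (R : realType) (N m : nat) (n : 'I_N -> nat)
    (A : forall i, 'M[R]_(m, n i)) (b : 'cV[R]_m)
    (xhat : nat -> blockvec R n) (k : nat) : (0 < k)%N ->
  k%:R *: residual A b (ergodic_average xhat k)
    = \sum_(p < k) residual A b (xhat p).
Proof.
move=> k_gt0; rewrite sumrB sumr_const card_ord scalerBr [_ *: b]scaler_nat.
congr (_ - _); rewrite exchange_big scaler_sumr; apply: eq_bigr => i _ /=.
rewrite -mulmx_sumr /ergodic_average -scalemxAr scalerA divff ?scale1r//.
by rewrite pnatr_eq0 -lt0n.
Qed.

Lemma objective_ergodic (R : realType) (N : nat) (n : 'I_N -> nat)
    (f : forall i, 'cV[R]_(n i) -> R)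
    (xhat : nat -> blockvec R n) (k : nat) :
    (forall i, @convex_function R 'cV[R]_(n i) setT (f i)) -> (0 < k)%N ->
  k%:R * objective f (ergodic_average xhat k)
    <= \sum_(p < k) objective f (xhat p).
Proof.
move=> cf k_gt0; rewrite exchange_big mulr_sumr; apply: ler_sum => i _.
exact: (jensen_average (fun p => xhat p i) (cf i) k_gt0).
Qed.

Theorem theorem1 (R : realType) (N m : nat) (n : 'I_N -> nat)
    (f : forall i : 'I_N, 'cV[R]_(n i) -> R)
    (X : forall i : 'I_N, set 'cV[R]_(n i))
    (A : forall i : 'I_N, 'M[R]_(m, n i)) (b : 'cV[R]_m)
    (rho tau : R)
    (xstar : blockvec R n) (lamstar : 'cV[R]_m)
    (x xhat : nat -> blockvec R n) (lam : nat -> 'cV[R]_m)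
    (f_convex : forall i, @convex_function R 'cV[R]_(n i) setT (f i))
    (X_convex : forall i, @convex_set R 'cV[R]_(n i) (X i))
    (X_closed : forall i, closed (X i))
    (X_bounded : forall i, bounded_set (X i))
    (saddle : saddle_point f X A b xstar lamstar)
    (rho_gt0 : 0 < rho)
    (tau_gt0 : 0 < tau)
    (* tau < 1/q, with 1/q read as +oo if q = 0, i.e. if A = 0 *)
    (tau_lt : tau * (max_degree A)%:R < 1)
    (adal : adal_sequence f X A b rho tau x xhat lam)
    (k : nat) (k_ge1 : (1 <= k)%N) :
  let xtilde := ergodic_average xhat k in
  let phi :=
    \sum_(i < N) rho * norm2 (A i *m (x 0%N i - xstar i)) ^+ 2
    + rho^-1 * (norm2 (lambda_bar A b rho tau (x 0%N) (lam 0%N)) + 1) ^+ 2 in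
  objective f xtilde - objective f xstar + norm2 (residual A b xtilde)
    <= (2 * k%:R * tau)^-1 * phi.
Proof.
cbv zeta; set xtilde := ergodic_average xhat k.
set phi := (X in _ <= _ * X).
have [xstarX _] := saddle.
have xstar0 := saddle_feasible saddle.
have [mu mu_le1 mur] := norm2_dual (residual A b xtilde).
have gap_sumE :
    \sum_(p < k) (objective f (xhat p) - objective f xstar
                  + dotv mu (residual A b (xhat p)))
    = \sum_(p < k) objective f (xhat p) - k%:R * objective f xstar
      + k%:R * norm2 (residual A b xtilde).
  rewrite big_split; congr (_ + _).
    by rewrite sumrB sumr_const card_ord mulr_natl.
  by rewrite -dotv_sumr -residual_ergodic// dotvZr mur.
have := merit_telescope mu k f_convex X_convex rho_gt0 tau_gt0 tau_lt
  xstarX xstar0 adal.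
rewrite gap_sumE => merit_le.
have merit_k_ge0 := merit_ge0 A b tau xstar mu (x k) (lam k) rho_gt0.
have merit0_le : merit A b rho tau xstar mu (x 0%N) (lam 0%N) <= phi.
  rewrite lerD2l ler_wpM2l ?invr_ge0 ?(ltW rho_gt0)//.
  rewrite ler_pXn2r ?nnegrE ?addr_ge0 ?norm2_ge0//.
  by apply: le_trans (norm2B_le _ _) _; rewrite lerD2l.
have k_gt0 : 0 < k%:R :> R by rewrite ltr0n.
rewrite ler_pdivlMl ?mulr_gt0//.
have := ler_wpM2l (ltW tau_gt0) (objective_ergodic xhat f_convex k_ge1).
by rewrite -/xtilde; lra.
Qed.
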